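(* Let $\alpha>0$, $x_0,y_0\in\mathbb R$, and let $(X_t,Y_t)_{t\ge 0}$ be the solution of the linear stochastic oscillator $$\mathrm dX_t=Y_t\,\mathrm dt,\qquad \mathrm dY_t=-X_t\,\mathrm dt+\alpha\,\mathrm dW_t,\qquad (X_0,Y_0)=(x_0,y_0).$$ For $T>0$ let $A_T=\frac1T\int_0^T X_t\,\mathrm dt$ be the mean position. Then $\{A_T\}_{T>0}$ satisfies a large deviations principle with the good rate function $I(y)=\frac{y^2}{3\alpha^2}$, i.e. $$\liminf_{T\to\infty}\frac1T\log\mathbf P(A_T\in U)\ge-\inf_{y\in U}I(y)\quad\text{for every open } U\subset\mathbb R,$$ $$\limsup_{T\to\infty}\frac1T\log\mathbf P(A_T\in C)\le-\inf_{y\in C}I(y)\quad\text{for every closed } C\subset\mathbb R.$$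
   Context: $W=(W_t)_{t\ge0}$ is a one-dimensional standard Brownian motion on a complete filtered probability space $(\Omega,\mathscr F,\{\mathscr F_t\}_{t\ge0},\mathbf P)$. The solution component $X_t$ is explicitly $X_t=x_0\cos(t)+y_0\sin(t)+\alpha\int_0^t\sin(t-s)\,\mathrm dW_s$. A rate function on a Polish space $E$ is a lower semicontinuous function $I:E\to[0,\infty]$; it is good if all level sets $\{y\in E: I(y)\le a\}$, $a\in[0,\infty)$, are compact. Conventions: $\log 0=-\infty$, $\inf\emptyset=+\infty$. *)

(* Defs.v *)
From HB Require Import structures.
From mathcomp Require Import all_boot all_order all_algebra.
From mathcomp Require Import all_classical all_reals all_analysis.

Set Implicit Arguments.
Unset Strict Implicit.
Unset Printing Implicit Defensive.

Import Order.TTheory GRing.Theory Num.Theory.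
Import numFieldNormedType.Exports.

Local Open Scope classical_set_scope.
Local Open Scope ring_scope.

(* Time runs over [0, +oo[: processes and filtrations are indexed by R, and
   their values at negative times are never used. *)

Section stochastic_oscillator.
Context (d : measure_display) (Omega : measurableType d) (R : realType).
Variable P : probability Omega R.
Implicit Types (F : R -> set (set Omega)) (X Y W : R -> Omega -> R).

Record complete_filtered_probability_space F : Prop := {
  cfps_complete : measure_is_complete P ;
  cfps_sigma_algebra : forall t : R, 0 <= t -> sigma_algebra [set: Omega] (F t) ;
  cfps_measurable : forall t : R, 0 <= t -> F t `<=` measurable ;
  cfps_mono : forall s t : R, 0 <= s -> s <= t -> F s `<=` F t ;
  cfps_negligible : P.-negligible `<=` F 0 }.

Definition adapted F X : Prop :=
  forall t : R, 0 <= t -> forall B : set R, measurable B -> F t (X t @^-1` B).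

Definition continuous_paths X : Prop :=
  {ae P, forall w, {within `[0, +oo[, continuous (fun t : R => X t w)}}.

(* [normal_prob] takes the standard deviation, not the variance. *)
Record standard_brownian_motion F W : Prop := {
  sbm_adapted : adapted F W ;
  sbm_continuous : continuous_paths W ;
  sbm_start : {ae P, forall w, W 0 w = 0} ;
  sbm_gaussian : forall s t : R, 0 <= s -> s < t ->
    forall B : set R, measurable B ->
      P ((W t \- W s) @^-1` B) = normal_prob 0 (Num.sqrt (t - s)) B ;
  sbm_independent : forall s t : R, 0 <= s -> s < t ->
    forall (A : set Omega) (B : set R), F s A -> measurable B ->
      P (A `&` (W t \- W s) @^-1` B)
      = (P A * P ((W t \- W s)%R @^-1` B))%E }.

(* The noise is additive, so the stochastic integral of the constant alpha over
   [0, t] is alpha * (W t - W 0) and the integral equations are pathwise. *)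
Record oscillator_solution (alpha x0 y0 : R) F W X Y : Prop := {
  osc_adapted_pos : adapted F X ;
  osc_adapted_vel : adapted F Y ;
  osc_continuous_pos : continuous_paths X ;
  osc_continuous_vel : continuous_paths Y ;
  osc_pos : {ae P, forall w (t : R), 0 <= t ->
    X t w = x0 + \int[lebesgue_measure]_(s in `[0, t]) Y s w} ;
  osc_vel : {ae P, forall w (t : R), 0 <= t ->
    Y t w = y0 - \int[lebesgue_measure]_(s in `[0, t]) X s w
            + alpha * (W t w - W 0 w)} }.

Definition mean_position X (T : R) (w : Omega) : R :=
  T^-1 * \int[lebesgue_measure]_(t in `[0, T]) X t w.

End stochastic_oscillator.

Section large_deviations.
Local Open Scope ereal_scope.
Context (R : realType) (E : topologicalType).

Definition rate_function (I : E -> \bar R) : Prop :=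
  (forall y, 0 <= I y) /\ lower_semicontinuous I.

Definition good_rate_function (I : E -> \bar R) : Prop :=
  rate_function I /\
  forall a : R, (0 <= a)%R -> compact [set y | I y <= a%:E].

Context (d : measure_display) (Omega : measurableType d).

(* [lne] sends 0 to -oo, and [ereal_inf] of the empty set is +oo. *)
Definition large_deviations_principle (P : probability Omega R)
    (A : R -> Omega -> E) (I : E -> \bar R) : Prop :=
  (forall U : set E, open U ->
     - ereal_inf [set I y | y in U] <=
     limf_einf (fun T : R => (T^-1)%:E * lne (P (A T @^-1` U))) +oo%R) /\
  (forall C : set E, closed C ->
     limf_esup (fun T : R => (T^-1)%:E * lne (P (A T @^-1` C))) +oo%R <=
     - ereal_inf [set I y | y in C]).

End large_deviations.

(* Main.v *)
Require Import Defs.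
From mathcomp Require Import all_boot all_order all_algebra.
From mathcomp Require Import all_classical all_reals all_analysis.
From mathcomp Require Import measurable_realfun ring lra.
Import Order.TTheory GRing.Theory Num.Theory.
Import numFieldNormedType.Exports.
Local Open Scope classical_set_scope.
Local Open Scope ring_scope.

(** Solving the pathwise equations gives
      [int_0^T X = x0 sin T + y0 (1 - cos T)
                   + alpha int_0^T sin (T - s) (W_s - W_0) ds],
    and a summation by parts turns Riemann sums of the last integral into sums
      [S_n = sum_k (1 - cos (T - t_{k+1})) (W_{t_{k+1}} - W_{t_k})]
    of independent centred Gaussians.  The variance of [S_n] is a Riemann sum of
    [int_0^T (1 - cos (T - s))^2 ds = 3 T / 2 + O(1)], which is where the
    constant in [y^2 / (3 alpha^2)] comes from.

    The law of the limit is never identified.  The moment generating function of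
    [S_n] is [exp (l^2 v / 2)] by independence; it yields the upper tail by
    Chernoff's bound, and the lower bound on intervals by exponential tilting.
    Both estimates depend on [n] only through the variance, so they survive the
    almost sure limit [n -> oo]; letting [T -> oo] then gives the two bounds. *)

Set Implicit Arguments.
Unset Strict Implicit.
Unset Printing Implicit Defensive.

(** * Gaussian moment generating functions *)

(** [normal_pdf] and the Radon-Nikodym derivative of [normal_prob] have the same integral over every
    measurable set, hence agree almost everywhere and may be exchanged in the change of
    variables. *)
Lemma integral_normal_prob (R : realType) (m s : R) (f : R -> \bar R) :
  (forall x : R, 0 <= f x)%E -> measurable_fun setT f ->
  (\int[normal_prob m s]_x f x =
   \int[lebesgue_measure]_x (f x * (normal_pdf m s x)%:E))%E.
Proof.
move=> f0 mf.
have dom := normal_prob_dominates m s.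
rewrite -(Radon_Nikodym_SigmaFinite.change_of_variables dom)//.
have hrn := Radon_Nikodym_SigmaFinite.f_integrable dom.
have hpdf : measurable_fun [set: R] (fun x => (normal_pdf m s x)%:E).
  by apply/measurable_EFinP; exact: measurable_normal_pdf.
apply: ge0_ae_eq_integral => //.
- by apply: emeasurable_funM => //; exact: measurable_int hrn.
- by apply: emeasurable_funM.
- by move=> x _; rewrite mule_ge0// Radon_Nikodym_SigmaFinite.f_ge0.
- by move=> x _; rewrite mule_ge0// lee_fin normal_pdf_ge0.
- apply: ae_eqe_mul2l; apply: integral_ae_eq => // A _ mA.
  by rewrite -Radon_Nikodym_SigmaFinite.f_integral.
Qed.

Lemma integral_normal_prob_expR (R : realType) (s : R) (l : R) : s != 0 ->
  (\int[normal_prob 0 s]_x (expR (l * x))%:E =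
   (expR (l ^+ 2 * s ^+ 2 / 2))%:E)%E.
Proof.
move=> s0; rewrite integral_normal_prob//; last first.
  by apply/measurable_EFinP; exact: measurableT_comp.
(* Completing the square shifts the mean to [l s^2]. *)
transitivity (\int[lebesgue_measure]_x ((expR (l ^+ 2 * s ^+ 2 / 2))%:E *
  (normal_pdf (l * s ^+ 2) s x)%:E))%E.
  apply: eq_integral => x _; rewrite -!EFinM; congr EFin.
  rewrite !normal_pdfE// mulrCA [RHS]mulrCA; congr (_ * _).
  rewrite /normal_fun -!expRD; congr expR; field.
  exact: s0.
rewrite ge0_integralZl//=; first by rewrite integral_normal_pdf mule1.
- by apply/measurable_EFinP; exact: measurable_normal_pdf.
- by move=> x _; rewrite lee_fin normal_pdf_ge0.
Qed.

Section independence.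
Local Open Scope ereal_scope.
Context d (Omega : measurableType d) (R : realType) (P : probability Omega R).

(** The product rule on preimages says that the joint law of [f] and [g] agrees with the product of
    their laws on rectangles, hence on all measurable sets; Tonelli then splits the integral. *)
Lemma ge0_integral_indepM (f g : Omega -> R) (F G : R -> \bar R) :
  measurable_fun setT f -> measurable_fun setT g ->
  (forall A B : set R, measurable A -> measurable B ->
     P (f @^-1` A `&` g @^-1` B) = P (f @^-1` A) * P (g @^-1` B)) ->
  measurable_fun setT F -> measurable_fun setT G ->
  (forall x, 0 <= F x) -> (forall x, 0 <= G x) ->
  \int[P]_w (F (f w) * G (g w)) = \int[P]_w F (f w) * \int[P]_w G (g w).
Proof.
move=> mf mg fg mF mG F0 G0.
pose X := mfun_Sub (mem_set mf : f \in mfun) : {RV P >-> R}.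
pose Y := mfun_Sub (mem_set mg : g \in mfun) : {RV P >-> R}.
have mfg : measurable_fun setT (fun w => (f w, g w)).
  exact: measurable_fun_pair.
pose mu := pushforward P (fun w => (f w, g w)).
pose FG (z : R * R) := F z.1 * G z.2.
have mFG : measurable_fun setT FG.
  by apply: emeasurable_funM; apply: measurableT_comp.
have FG0 z : 0 <= FG z by exact: mule_ge0.
transitivity (\int[mu]_z FG z).
  by rewrite ge0_integral_pushforward.
transitivity (\int[distribution P X \x distribution P Y]_z FG z).
  apply: eq_measure_integral => A mA _; apply/esym.
  by apply: product_measure_unique => // B C mB mC; exact: fg.
rewrite fubini_tonelli1//= /fubini_F /FG/=.
under eq_integral do rewrite ge0_integralZl//.
rewrite ge0_integralZr//; last exact: integral_ge0.
by rewrite !ge0_integral_distribution.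
Qed.

End independence.

Section gaussian_mgf.
Context d (Omega : measurableType d) (R : realType) (P : probability Omega R).
Implicit Types (Z : Omega -> R) (c r v : R).

(** This keeps of the centred Gaussian law of variance [v] exactly what Chernoff's bound and tilting
    consume, in a form that multiplies over independent summands. *)
Definition gaussian_mgf Z v := measurable_fun setT Z /\
  forall l : R, (\int[P]_w (expR (l * Z w))%:E = (expR (l ^+ 2 * v / 2))%:E)%E.

Lemma measurable_expR_scale Z l (D : set Omega) : measurable_fun setT Z ->
  measurable_fun D (fun w => (expR (l * Z w))%:E).
Proof.
move=> mZ; apply: measurable_funTS; apply/measurable_EFinP.
by apply: measurableT_comp => //; exact: measurable_funM.
Qed.

Lemma gaussian_mgfN Z v : gaussian_mgf Z v -> gaussian_mgf (fun w => - Z w) v.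
Proof.
move=> [mZ hZ]; split; first exact: measurable_funN.
move=> l; under eq_integral do rewrite mulrN -mulNr.
by rewrite hZ sqrrN.
Qed.

Lemma gaussian_mgfZ a Z v : gaussian_mgf Z v ->
  gaussian_mgf (fun w => a * Z w) (a ^+ 2 * v).
Proof.
move=> [mZ hZ]; split; first exact: measurable_funM.
move=> l; under eq_integral do rewrite mulrA.
by rewrite hZ exprMn mulrA.
Qed.

Lemma measurable_ge Z c : measurable_fun setT Z ->
  measurable [set w | (c <= Z w)%R].
Proof.
move=> mZ; rewrite (_ : [set _ | _] = Z @^-1` `[c, +oo[).
  by rewrite -[X in measurable X]setTI; exact: mZ.
by apply/seteqP; split => w/=; rewrite in_itv/= andbT.
Qed.

(** On the event [c <= Z] the weight [expR (l * Z)] is at most [expR ((l + e) * Z - e * c)]. With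
    [l = 0] this is Chernoff's bound; other [l] give the same bound under the exponentially tilted
    measure. *)
Lemma tilted_tail_le Z v (l e c : R) : gaussian_mgf Z v -> 0 <= e ->
  (\int[P]_(w in [set w | (c <= Z w)%R]) (expR (l * Z w))%:E <=
   (expR ((l + e) ^+ 2 * v / 2 - e * c))%:E)%E.
Proof.
move=> [mZ hZ] e0.
rewrite expRD EFinM -hZ muleC -ge0_integralZl//=; last first.
  exact: measurable_expR_scale.
apply: (@le_trans _ _ (\int[P]_(w in [set w | (c <= Z w)%R])
   ((expR (- (e * c)))%:E * (expR ((l + e) * Z w))%:E)%E)%E).
  apply: ge0_le_integral => //.
  - exact: measurable_ge.
  - exact: measurable_expR_scale.
  - by apply: emeasurable_funM => //; exact: measurable_expR_scale.
  - move=> w /= cZ; rewrite -EFinM lee_fin -expRD ler_expR.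
    by have := ler_wpM2l e0 cZ; lra.
apply: ge0_subset_integral => //; first exact: measurable_ge.
by apply: emeasurable_funM => //; exact: measurable_expR_scale.
Qed.

(** Chernoff's bound with the exponent [r / V], optimal for variance [V]. The slack [v <= V] lets a
    single bound serve all Riemann sums at once. *)
Lemma gaussian_upper_tail Z v V r : gaussian_mgf Z v -> v <= V -> 0 < V ->
  0 <= r -> (P [set w | (r <= Z w)%R] <= (expR (- (r ^+ 2 / (2 * V))))%:E)%E.
Proof.
move=> hZ vV V0 r0; have rV : 0 <= r / V by rewrite divr_ge0// ltW.
have := tilted_tail_le 0 r hZ rV.
under eq_integral do rewrite mul0r expR0.
rewrite integral_cst//=; last by apply: measurable_ge; case: hZ.
rewrite mul1e => /le_trans; apply; rewrite lee_fin ler_expR add0r.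
apply: (@le_trans _ _ ((r / V) ^+ 2 * V / 2 - r / V * r)).
  by rewrite lerD2r ler_pM2r// ler_wpM2l// sqr_ge0.
rewrite le_eqVlt; apply/orP; left; apply/eqP; field; exact: lt0r_neq0.
Qed.

Lemma gaussian_interval_ge Z v c e : gaussian_mgf Z v -> 0 < v -> 0 < e ->
  ((expR (- ((c ^+ 2 + 2 * `|c| * e) / (2 * v))) *
    (1 - 2 * expR (- (e ^+ 2 / (2 * v)))))%:E <=
   P [set w | (`|Z w - c| < e)%R])%E.
Proof.
wlog c0 : Z c / 0 <= c.
  move=> h hZ v0 e0; have [c0|c0] := leP 0 c; first exact: h.
  have := h (fun w => - Z w) (- c) _ (gaussian_mgfN hZ) v0 e0.
  rewrite oppr_ge0 (ltW c0) => /(_ isT).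
  rewrite sqrrN normrN => /le_trans; apply.
  rewrite le_eqVlt; apply/orP; left; apply/eqP; congr (P _).
  by apply/seteqP; split => w/=; rewrite -opprD normrN.
move=> hZ v0 e0; have [mZ hM] := hZ.
rewrite (ger0_norm c0).
(* Tilting by [exp (l Z)] with [l = c / v] moves the mean of [Z] to [c], and the
   tilted mass outside the interval is again bounded by Chernoff. *)
set l := c / v; have l0 : 0 <= l by rewrite divr_ge0// ltW.
have ev0 : 0 <= e / v by rewrite divr_ge0// ltW.
set I := [set w | _]; set U := [set w | c + e <= Z w].
set L := [set w | - (c - e) <= - Z w].
have mU : measurable U by exact: measurable_ge.
have mL : measurable L by apply: measurable_ge; exact: measurable_funN.
have IE : I = ~` (U `|` L).
  apply/seteqP; split => w /=; rewrite /I/U/L/= lerN2.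
    rewrite ltr_norml => /andP[h1 h2] []; lra.
  by move=> /not_orP[/negP + /negP]; rewrite -!ltNge ltr_norml => h1 h2; lra.
have mI : measurable I by rewrite IE; apply: measurableC; exact: measurableU.
have hU : (\int[P]_(w in U) (expR (l * Z w))%:E <=
    (expR (l ^+ 2 * v / 2) * expR (- (e ^+ 2 / (2 * v))))%:E)%E.
  apply: (le_trans (tilted_tail_le l (c + e) hZ ev0)).
  rewrite lee_fin -expRD ler_expR /l le_eqVlt; apply/orP; left; apply/eqP.
  by field; exact: lt0r_neq0.
have hL : (\int[P]_(w in L) (expR (l * Z w))%:E <=
    (expR (l ^+ 2 * v / 2) * expR (- (e ^+ 2 / (2 * v))))%:E)%E.
  (* The lower tail of [Z] is the upper tail of [- Z], for which the tilt by [l] becomes a tilt by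
     [- l]. *)
  have := tilted_tail_le (- l) (- (c - e)) (gaussian_mgfN hZ) ev0.
  under eq_integral do rewrite mulrNN.
  move=> /le_trans; apply.
  rewrite lee_fin -expRD ler_expR /l le_eqVlt; apply/orP; left; apply/eqP.
  by field; exact: lt0r_neq0.
(* Undoing the tilt: on [I] the tilting weight is at most [expR (l * (c + e))], because [l] is
   nonnegative and [Z < c + e] there. *)
have hI : (\int[P]_(w in I) (expR (l * Z w))%:E <=
    (expR (l * (c + e)))%:E * P I)%E.
  rewrite -(integral_cst P mI (expR (l * (c + e)))%:E).
  apply: ge0_le_integral => //.
  - exact: measurable_expR_scale.
  - move=> w; rewrite /I/= ltr_norml => h.
    by rewrite lee_fin ler_expR ler_wpM2l//; lra.
have hT : ((expR (l ^+ 2 * v / 2))%:E <= \int[P]_(w in I) (expR (l * Z w))%:E +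
   (\int[P]_(w in U) (expR (l * Z w))%:E +
    \int[P]_(w in L) (expR (l * Z w))%:E))%E.
  have mUL : measurable (U `|` L) by exact: measurableU.
  rewrite -hM -(setvU (U `|` L)) -IE ge0_integral_setU//=.
  - rewrite leeD2l// (_ : U `|` L = U `|` (L `\` U)); last first.
      by apply/seteqP; split => w /=; case: (pselect (U w)); tauto.
    rewrite ge0_integral_setU//=.
    + rewrite leeD2l//; apply: ge0_subset_integral => //.
      * exact: measurableD.
      * exact: measurable_expR_scale.
    + exact: measurableD.
    + exact: measurable_expR_scale.
    + by apply/disj_setPS => w [/= ? []].
  - exact: measurable_expR_scale.
  - by rewrite IE; apply/disj_setPS => w [].
have PIfin : P I \is a fin_num by exact: fin_num_measure.
rewrite -(fineK PIfin) in hI *.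
have := le_trans hT (leeD hI (leeD hU hL)).
rewrite -EFinM -!EFinD !lee_fin => h.
rewrite -(ler_pM2l (expR_gt0 (l * (c + e)))).
have -> : expR (l * (c + e)) * (expR (- ((c ^+ 2 + 2 * c * e) / (2 * v))) *
   (1 - 2 * expR (- (e ^+ 2 / (2 * v))))) =
   expR (l ^+ 2 * v / 2) * (1 - 2 * expR (- (e ^+ 2 / (2 * v)))).
  rewrite mulrA -expRD; congr (expR _ * _); rewrite /l; field; exact: lt0r_neq0.
lra.
Qed.

End gaussian_mgf.

(** * Brownian sums *)

Section brownian_sums.
Context d (Omega : measurableType d) (R : realType) (P : probability Omega R).
Variables (F : R -> set (set Omega)) (W : R -> Omega -> R).
Hypothesis hF : complete_filtered_probability_space P F.
Hypothesis hW : standard_brownian_motion P F W.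

(** [F t] is already a sigma-algebra, so generating one from it adds no sets. Adaptedness thus
    becomes measurability of a function, to which the closure rules for sums and products apply. *)
Lemma filtration_measurable_funP (t : R) (f : Omega -> R) : 0 <= t ->
  (forall B : set R, measurable B -> F t (f @^-1` B)) <->
  measurable_fun [set: g_sigma_algebraType (F t)] f.
Proof.
move=> t0; have sF := sigma_algebra_id (cfps_sigma_algebra hF t0).
split=> [h _ B mB|h B mB].
  by rewrite setTI; apply: sub_sigma_algebra; exact: h.
by have := h measurableT B mB; rewrite setTI /measurable/= sF.
Qed.

Lemma filtration_measurable_fun (t : R) (f : Omega -> R) : 0 <= t ->
  measurable_fun [set: g_sigma_algebraType (F t)] f ->
  measurable_fun [set: Omega] f.
Proof.
move=> t0 /filtration_measurable_funP-/(_ t0) h _ B mB; rewrite setTI.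
exact: (cfps_measurable hF t0 (h B mB)).
Qed.

Lemma brownian_measurable (s t : R) : 0 <= s -> s <= t ->
  measurable_fun [set: g_sigma_algebraType (F t)] (W s).
Proof.
move=> s0 st; apply/filtration_measurable_funP; first exact: le_trans st.
move=> B mB; apply: (cfps_mono hF s0 st); exact: (sbm_adapted hW).
Qed.

Lemma brownian_increment_mgf (s t : R) : 0 <= s -> s < t ->
  gaussian_mgf P (fun w => W t w - W s w) (t - s).
Proof.
move=> s0 st; have t0 : 0 <= t by rewrite (le_trans s0)// ltW.
have mD : measurable_fun [set: Omega] (fun w => W t w - W s w).
  apply: (filtration_measurable_fun t0); apply: measurable_funB.
    exact: brownian_measurable.
  exact: brownian_measurable (ltW st).
split => // l.
pose D := mfun_Sub (mem_set mD : (fun w => W t w - W s w) \in mfun)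
  : {RV P >-> R}.
have ml : measurable_fun [set: R] (fun x => (expR (l * x))%:E).
  by apply/measurable_EFinP; exact: measurableT_comp.
transitivity (\int[distribution P D]_x (expR (l * x))%:E)%E.
  by rewrite ge0_integral_distribution.
have ts : 0 < t - s by rewrite subr_gt0.
transitivity (\int[normal_prob 0 (Num.sqrt (t - s))]_x (expR (l * x))%:E)%E;
    last first.
  rewrite integral_normal_prob_expR ?sqr_sqrtr ?ltW//.
  by rewrite gt_eqF// sqrtr_gt0.
(* [normal_prob] lives on [measurableTypeR R], whose display is not convertible
   to that of [R], hence the detour through the identity. *)
pose idR : measurableTypeR R -> R := idfun.
have midR : measurable_fun setT idR by move=> _ B mB; rewrite setTI.
transitivity (\int[pushforward (normal_prob 0 (Num.sqrt (t - s))) idR]_x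
  (expR (l * x))%:E)%E; last by rewrite ge0_integral_pushforward.
apply: eq_measure_integral => B mB _.
exact: (sbm_gaussian hW s0 st mB).
Qed.

(** Induction on [m]: the partial sum depends only on the past up to [m%:R * h], so the next
    increment is independent of it and the generating functions multiply. The first conjunct records
    that dependence on the past. *)
Lemma brownian_sum_mgf (h : R) (a : nat -> R) (m : nat) : 0 < h ->
  measurable_fun [set: g_sigma_algebraType (F (m%:R * h))]
    (fun w => \sum_(k < m) a k * (W (k.+1%:R * h) w - W (k%:R * h) w)) /\
  gaussian_mgf P
    (fun w => \sum_(k < m) a k * (W (k.+1%:R * h) w - W (k%:R * h) w))
    (\sum_(k < m) a k ^+ 2 * h).
Proof.
move=> h0; have th k : 0 <= k%:R * h by rewrite mulr_ge0// ltW.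
have thS k : k%:R * h < k.+1%:R * h by rewrite ltr_pM2r// ltr_nat.
have mS n : measurable_fun [set: g_sigma_algebraType (F (n%:R * h))]
    (fun w => \sum_(k < n) a k * (W (k.+1%:R * h) w - W (k%:R * h) w)).
  apply: measurable_sum => k; apply: measurable_funM => //.
  by apply: measurable_funB; apply: brownian_measurable;
     rewrite ?ler_pM2r ?ler_nat// ltnW.
split=> //; split; first exact: filtration_measurable_fun (mS m).
elim: m => [|m IHm] l.
  under eq_integral do rewrite big_ord0 mulr0 expR0.
  by rewrite big_ord0 integral_cst//= mul1e probability_setT mulr0 mul0r expR0.
pose S w := \sum_(k < m) a k * (W (k.+1%:R * h) w - W (k%:R * h) w).
pose D w := W (m.+1%:R * h) w - W (m%:R * h) w.
have [mD hD] := brownian_increment_mgf (th m) (thS m).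
under eq_integral => w _.
  rewrite big_ord_recr/= mulrDr mulrA expRD EFinM; over.
rewrite (@ge0_integral_indepM _ _ _ P S D (fun x => (expR (l * x))%:E)
  (fun x => (expR (l * a m * x))%:E)) //.
- rewrite IHm hD -EFinM -expRD big_ord_recr/= -mulrBl -natrB// subSnn mul1r.
  by congr ((expR _)%:E); ring.
- exact: filtration_measurable_fun (mS m).
- move=> A B mA mB; apply: (sbm_independent hW) => //.
  by have /filtration_measurable_funP := mS m; exact.
- by apply/measurable_EFinP; exact: measurableT_comp.
- by apply/measurable_EFinP; exact: measurableT_comp.
Qed.

End brownian_sums.

(** * The pathwise equation *)

Lemma within_itv_continuous_dist (R : realType) (a b : R) (f : R -> R) (x : R) :
  {within `[a, b], continuous f} -> x \in `[a, b] -> forall e, 0 < e ->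
  exists2 r, 0 < r &
    forall y, y \in `[a, b] -> `|x - y| < r -> `|f x - f y| < e.
Proof.
move=> cf xab e e0; have xab' : `[a, b]%classic x by [].
have /cvgrPdist_lt/(_ e e0) := cf x.
rewrite {1}/nbhs/= -(nbhs_subspace_in xab') near_withinE => /nbhs_ballP[r r0 h].
by exists r => // y yab xy; exact: h.
Qed.

(** Heine's theorem, through the near-covering form of compactness. Halving the local radius [r]
    keeps both [z] and [y] within [r] of the centre [x]. *)
Lemma within_itv_continuous_unif (R : realType) (a b : R) (f : R -> R) :
  {within `[a, b], continuous f} ->
  forall e, 0 < e -> exists2 r, 0 < r &
    forall x y, x \in `[a, b] -> y \in `[a, b] -> `|x - y| < r ->
      `|f x - f y| < e.
Proof.
move=> cf e e0.
have /compact_near_coveringP cov := @segment_compact R a b.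
pose Q (r x : R) := x \in `[a, b] -> forall y, y \in `[a, b] ->
  `|x - y| < r -> `|f x - f y| < e.
have covQ : \forall r \near (0 : R)^'+, `[a, b] `<=` Q r.
  apply: cov.
  move=> x xab; have e2 : 0 < e / 2 by rewrite divr_gt0.
  have [r r0 h] := within_itv_continuous_dist cf xab e2.
  have r2 : 0 < r / 2 by rewrite divr_gt0.
  exists (ball x (r / 2), [set d | d < r / 2]).
    by split => /=; [exact: nbhsx_ballx|exact: nbhs_right_lt].
  move=> [z d] /= [xz dr] zab y yab zy.
  have xz' : `|x - z| < r / 2 by [].
  have h1 : `|f x - f z| < e / 2 by apply: h => //; lra.
  have h2 : `|f x - f y| < e / 2.
    apply: h => //; rewrite (_ : x - y = (x - z) + (z - y)); last by ring.
    by apply: (le_lt_trans (ler_normD _ _)); lra.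
  rewrite (_ : f z - f y = (f x - f y) - (f x - f z)); last by ring.
  by apply: (le_lt_trans (ler_normB _ _)); lra.
near (0 : R)^'+ => r; exists r; first by near: r; exact: nbhs_right_gt.
move=> x y xab; apply: (near covQ r) => //.
Unshelve. all: by end_near. Qed.

(** * Riemann sums for the variance *)

Lemma cos_lipschitz (R : realType) (x y : R) : `|cos x - cos y| <= `|x - y|.
Proof.
wlog xy : x y / x <= y.
  move=> h; have [/h//|/ltW/h] := leP x y.
  by rewrite distrC (distrC y).
have [c _] := MVT_segment xy (fun z _ => is_derive_cos z)
  (continuous_subspaceT (@continuous_cos R)).
rewrite distrC => ->; rewrite normrM normrN distrC ler_piMl//.
by rewrite ler_norml sin_geN1 sin_le1.
Qed.

Lemma one_sub_cos_sqr_lipschitz (R : realType) (x y : R) :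
  `|(1 - cos x) ^+ 2 - (1 - cos y) ^+ 2| <= 4 * `|x - y|.
Proof.
rewrite subr_sqr normrM mulrC ler_pM//.
  (* Both [1 - cos x] and [1 - cos y] lie between 0 and 2, so the factor given by their sum is at
     most 4. *)
  rewrite ler_norml; have := cos_le1 x; have := cos_le1 y.
  by have := cos_geN1 x; have := cos_geN1 y; lra.
rewrite (_ : _ - _ = cos y - cos x); last by ring.
by rewrite distrC cos_lipschitz.
Qed.

(** By the mean value theorem each cell errs by at most [4 * h * h], hence [4 * T * h] in total. The
    [5 / 2] bounds the oscillating terms [2 * sin T] and [2^-1 * (sin T * cos T)] of the exact
    integral. *)
Lemma one_sub_cos_sqr_sum (R : realType) (T h : R) (n : nat) :
  0 < h -> n%:R * h = T ->
  `|\sum_(k < n) (1 - cos (T - k.+1%:R * h)) ^+ 2 * h - 3 / 2 * T|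
    <= 4 * T * h + 5 / 2.
Proof.
move=> h0 hT.
(* [- V] is [x |-> int_0^(T - x) (1 - cos u)^2 du]. *)
pose V (x : R) :=
  - (3 / 2 * (T - x) - 2 * sin (T - x) + 2^-1 * (sin (T - x) * cos (T - x))).
pose dV (x : R) := (1 - cos (T - x)) ^+ 2.
have VdV (x : R) : is_derive x 1 V (dV x).
  apply: is_derive_eq.
  rewrite /dV /GRing.scale/=.
  have := cos2Dsin2 (T - x); rewrite !expr2; nra.
have cV : continuous V.
  move=> x; apply: differentiable_continuous; apply/derivable1_diffP.
  exact: @ex_derive _ _ _ _ _ _ _ (VdV x).
pose t (k : nat) := k%:R * h.
have tS k : t k.+1 - t k = h by rewrite /t -mulrBl -natrB// subSnn mul1r.
have VT : \sum_(k < n) (V (t k.+1) - V (t k)) =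
    3 / 2 * T - 2 * sin T + 2^-1 * (sin T * cos T).
  rewrite -(big_mkord xpredT (fun k => V (t k.+1) - V (t k))).
  rewrite (telescope_sumr (fun k => V (t k)))// /V /t hT subrr mul0r subr0 sin0.
  by ring.
have step k : `|(1 - cos (T - t k.+1)) ^+ 2 * h - (V (t k.+1) - V (t k))|
    <= 4 * h * h.
  have tk : t k <= t k.+1 by rewrite -subr_ge0 tS ltW.
  have [c + ->] := MVT_segment tk (fun z _ => VdV z) (continuous_subspaceT cV).
  rewrite tS -mulrBl normrM (gtr0_norm h0) in_itv/= => /andP[c1 c2].
  rewrite ler_pM2r//; apply: (le_trans (one_sub_cos_sqr_lipschitz _ _)).
  rewrite ler_pM2l// (_ : _ - _ = c - t k.+1); last by ring.
  have := tS k; rewrite ler_norml; lra.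
have hS : `|\sum_(k < n) (1 - cos (T - t k.+1)) ^+ 2 * h -
   \sum_(k < n) (V (t k.+1) - V (t k))| <= 4 * T * h.
  rewrite -sumrB; apply: (le_trans (ler_norm_sum _ _ _)).
  apply: (@le_trans _ _ (\sum_(k < n) 4 * h * h)).
    by apply: ler_sum => k _; exact: step.
  rewrite sumr_const card_ord -mulr_natl -hT.
  by rewrite le_eqVlt; apply/orP; left; apply/eqP; ring.
move: hS; rewrite VT !ler_norml => /andP[h1 h2].
have := sin_le1 T; have := sin_geN1 T; have := cos_le1 T; have := cos_geN1 T.
move=> c1 c2 s1 s2.
have [sc1 sc2] : -1 <= sin T * cos T /\ sin T * cos T <= 1 by split; nra.
by apply/andP; split; lra.
Qed.

(** Summation by parts moves the differences from [c] to [w]. For [c k = cos (T - k%:R * h)] the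
    final value is [cos 0 = 1], which yields the weights [1 - cos] on Brownian increments. *)
Lemma abel_sum (R : comRingType) (w c : nat -> R) (m : nat) :
  \sum_(k < m) (w k - w 0) * (c k.+1 - c k) =
  \sum_(k < m) (c m - c k.+1) * (w k.+1 - w k).
Proof.
elim: m => [|m IHm]; first by rewrite !big_ord0.
rewrite !big_ord_recr/= subrr mul0r addr0 IHm.
have -> : w m - w 0 = \sum_(k < m) (w k.+1 - w k).
  by rewrite -(big_mkord xpredT (fun k => w k.+1 - w k)) telescope_sumr.
rewrite mulr_suml -big_split/=; apply: eq_bigr => k _; ring.
Qed.

(** * The position integral as a limit of Brownian sums *)

Section oscillator_path.
Context (R : realType) (X Y W : R -> R) (alpha x0 y0 T : R).
Hypotheses (T0 : 0 < T) (alpha0 : 0 < alpha).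
Hypothesis cX : {within `[0, T], continuous X}.
Hypothesis cY : {within `[0, T], continuous Y}.
Hypothesis cW : {within `[0, T], continuous W}.
Hypothesis eX : forall t, t \in `[0, T] ->
  X t = x0 + \int[lebesgue_measure]_(s in `[0, t]) Y s.
Hypothesis eY : forall t, t \in `[0, T] ->
  Y t = y0 - \int[lebesgue_measure]_(s in `[0, t]) X s + alpha * (W t - W 0).

Let J t := \int[lebesgue_measure]_(s in `[0, t]) X s.

Lemma integral_itv_derive (f : R -> R) (s : R) :
  {within `[0, T], continuous f} ->
  s \in `]0, T[ ->
  is_derive s 1 (fun t => \int[lebesgue_measure]_(u in `[0, t]) f u) (f s).
Proof.
move=> cf /[dup] sT; rewrite in_itv/= => /andP[s0 sltT].
have fi : lebesgue_measure.-integrable `[0, T] (EFin \o f).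
  by apply: continuous_compact_integrable => //; exact: segment_compact.
have [cfo _ _] := (continuous_within_itvP f T0).1 cf.
have [df1 df2] := continuous_FTC1_closed sltT fi s0 (cfo s sT).
apply: DeriveDef => //.
by rewrite -derive1E.
Qed.

(* The terms in [X s] cancel in the derivative of [H], and [Y s + J s] is
   [y0 + alpha * (W s - W 0)]. *)
Let H s := sin (T - s) * X s + cos (T - s) * J s.

Let dX s : s \in `]0, T[ -> is_derive s 1 X (Y s).
Proof.
move=> sT; have dJ := integral_itv_derive cY sT.
have : is_derive s 1
    (fun t => x0 + \int[lebesgue_measure]_(u in `[0, t]) Y u) (Y s).
  by apply: is_derive_eq; rewrite add0r mul1r.
apply: near_eq_is_derive => //.
near=> t; apply/esym/eX.
have : t \in `]0, T[ by near: t; exact: near_in_itvoo.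
by apply: subset_itv_oo_cc.
Unshelve. all: by end_near. Qed.

Let dH s : s \in `]0, T[ ->
  is_derive s 1 H (sin (T - s) * (y0 + alpha * (W s - W 0))).
Proof.
move=> sT; have dX' := dX sT.
have dJ : is_derive s 1 J (X s) := integral_itv_derive cX sT.
apply: is_derive_eq; rewrite /GRing.scale/= (eY (subset_itv_oo_cc sT)) -/(J s).
ring.
Qed.

Let cos_reflect_continuous (A : set R) :
  {within A, continuous (fun s => cos (T - s))}.
Proof.
apply: continuous_subspaceT => s.
apply: continuous_comp; last exact: continuous_cos.
by apply: cvgB; [exact: cvg_cst|exact: cvg_id].
Qed.

Let cH : {within `[0, T], continuous H}.
Proof.
have cs : {within `[0, T], continuous (fun s => sin (T - s))}.
  apply: continuous_subspaceT => s.
  apply: continuous_comp; last exact: continuous_sin.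
  by apply: cvgB; [exact: cvg_cst|exact: cvg_id].
have cJ : {within `[0, T], continuous J}.
  apply: parameterized_integral_continuous; first exact: ltW.
  by apply: continuous_compact_integrable => //; exact: segment_compact.
by move=> s; apply: cvgD; apply: cvgM;
  [exact: cs|exact: cX|exact: cos_reflect_continuous|exact: cJ].
Qed.

(** Freezing [W] at the left end [a] of the cell turns the increment of [H] into one of
    [c * cos (T - s)]. The difference [D] has derivative [sin (T - s) * alpha * (W s - W a)], which
    uniform continuity makes small. *)
Let step (h r e : R) (k : nat) : 0 < h -> h < r -> 0 < e -> k.+1%:R * h <= T ->
  (forall x y, x \in `[0, T] -> y \in `[0, T] -> `|x - y| < r ->
    `|W x - W y| < e) ->
  `|H (k.+1%:R * h) - H (k%:R * h) - (y0 + alpha * (W (k%:R * h) - W 0)) *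
    (cos (T - k.+1%:R * h) - cos (T - k%:R * h))| <= alpha * e * h.
Proof.
move=> h0 hr e0 kT unifW.
set a := k%:R * h; set b := k.+1%:R * h.
have bT : b <= T by [].
have ba : b - a = h by rewrite /b /a -mulrBl -natrB// subSnn mul1r.
have a0 : 0 <= a by rewrite mulr_ge0// ltW.
have ab : a <= b by rewrite -subr_ge0 ba ltW.
pose c := y0 + alpha * (W a - W 0).
pose D s := H s - c * cos (T - s).
have dD s : s \in `]a, b[ ->
    is_derive s 1 D (sin (T - s) * alpha * (W s - W a)).
  rewrite in_itv/= => /andP[s1 s2].
  have sT : s \in `]0, T[ by rewrite in_itv/=; apply/andP; split; lra.
  have dHs := dH sT.
  by apply: is_derive_eq; rewrite /c /GRing.scale/=; ring.
have cD : {within `[a, b], continuous D}.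
  move=> x; apply: cvgB; move: x.
    apply: (@continuous_subspaceW _ _ _ `[0, T]).
      by apply: subset_itv; rewrite bnd_simp.
    exact: cH.
  by move=> s; apply: cvgM; [exact: cvg_cst|exact: cos_reflect_continuous].
have [s + Ds] := MVT_segment ab dD cD.
rewrite in_itv/= => /andP[s1 s2].
rewrite (_ : _ - _ = D b - D a); last by rewrite /D /c; ring.
rewrite Ds ba !normrM (gtr0_norm h0) (gtr0_norm alpha0) ler_pM2r//.
have sin1 : `|sin (T - s)| <= 1 by rewrite ler_norml sin_geN1 sin_le1.
have Ws : `|W s - W a| < e.
  apply: unifW; first by rewrite in_itv/=; apply/andP; split; lra.
    by rewrite in_itv/=; apply/andP; split; lra.
  by rewrite ger0_norm; lra.
rewrite -[leRHS]mul1r -mulrA ler_pM//; first by rewrite mulr_ge0// ltW.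
by rewrite ler_pM2l// ltW.
Qed.

Lemma oscillator_path_sum :
  (fun n : nat => let h := T / n.+1%:R in x0 * sin T + y0 * (1 - cos T) +
     alpha * \sum_(k < n.+1) (1 - cos (T - k.+1%:R * h)) *
       (W (k.+1%:R * h) - W (k%:R * h))) @ \oo --> J T.
Proof.
apply/cvgrPdist_le => e e0.
(* With this modulus each cell errs by at most [(e / T) * h], and the cells of total length [T] sum
   to [e]. *)
have d0 : 0 < e / (alpha * T) by rewrite divr_gt0// mulr_gt0.
have [r r0 unifW] := within_itv_continuous_unif cW d0.
near=> n => /=.
set h := T / n.+1%:R.
have h0 : 0 < h by rewrite divr_gt0.
have nh : n.+1%:R * h = T by rewrite /h mulrCA divff ?mulr1// gt_eqF.
have hr : h < r.
  rewrite /h ltr_pdivrMr// -ltr_pdivrMl//.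
  rewrite (lt_le_trans (_ : _ < n%:R))// ?ler_nat//.
  by near: n; exact: nbhs_infty_gtr.
pose w k := W (k%:R * h); pose c k := cos (T - k%:R * h).
have cn : c n.+1 = 1 by rewrite /c nh subrr cos0.
(* At the right end only [J] survives in [H], at the left end only the initial position; telescoping
   [H] therefore gives [J T - x0 * sin T]. *)
have HT : H T = J T by rewrite /H subrr sin0 cos0 mul0r add0r mul1r.
have H0 : H 0 = x0 * sin T.
  have J0 : J 0 = 0 by rewrite /J set_itv1 Rintegral_set1.
  rewrite /H subr0 J0 mulr0 addr0 mulrC eX ?set_itv1 ?Rintegral_set1 ?addr0//.
  by rewrite in_itv/= lexx ltW.
have -> : \sum_(k < n.+1) (1 - cos (T - k.+1%:R * h)) *
    (W (k.+1%:R * h) - W (k%:R * h)) =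
    \sum_(k < n.+1) (w k - w 0%N) * (c k.+1 - c k).
  by rewrite abel_sum cn.
have -> : J T - (x0 * sin T + y0 * (1 - cos T) +
     alpha * \sum_(k < n.+1) (w k - w 0%N) * (c k.+1 - c k)) =
  \sum_(k < n.+1) (H (k.+1%:R * h) - H (k%:R * h) -
      (y0 + alpha * (W (k%:R * h) - W 0)) *
      (cos (T - k.+1%:R * h) - cos (T - k%:R * h))).
  rewrite sumrB.
  rewrite -(big_mkord xpredT (fun k => H (k.+1%:R * h) - H (k%:R * h))).
  rewrite (telescope_sumr (fun k => H (k%:R * h)))// nh mul0r HT H0.
  have -> : \sum_(k < n.+1) (y0 + alpha * (W (k%:R * h) - W 0)) *
      (cos (T - k.+1%:R * h) - cos (T - k%:R * h)) =
      y0 * (1 - cos T) + alpha * \sum_(k < n.+1) (w k - w 0%N) * (c k.+1 - c k).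
    have -> : 1 - cos T = \sum_(k < n.+1) (c k.+1 - c k).
      rewrite -(big_mkord xpredT (fun k => c k.+1 - c k)) telescope_sumr// cn.
      by rewrite /c mul0r subr0.
    rewrite !mulr_sumr -big_split/=; apply: eq_bigr => k _.
    by rewrite mulrDl -mulrA /w mul0r.
  by ring.
apply: (le_trans (ler_norm_sum _ _ _)).
apply: (@le_trans _ _ (\sum_(k < n.+1) alpha * (e / (alpha * T)) * h)).
  apply: ler_sum => k _; apply: (@step h r) => //.
  by rewrite -nh ler_pM2r// ler_nat.
rewrite sumr_const card_ord -mulr_natl mulrCA nh.
rewrite le_eqVlt; apply/orP; left; apply/eqP; field.
by rewrite !gt_eqF.
Unshelve. all: by end_near. Qed.

End oscillator_path.

(** * Bounds at a fixed time *)

Lemma open_dist_gt (R : realType) (a s : R) : open [set x : R | s < `|x - a|].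
Proof.
rewrite (_ : [set _ | _] = (fun x => `|x - a|) @^-1` [set x | s < x])//.
apply: open_comp; last exact: open_gt.
by move=> x _; apply: cvg_norm; apply: cvgB; [exact: cvg_id|exact: cvg_cst].
Qed.

Lemma open_dist_lt (R : realType) (a s : R) : open [set x : R | `|x - a| < s].
Proof.
rewrite (_ : [set _ | _] = (fun x => `|x - a|) @^-1` [set x | x < s])//.
apply: open_comp; last exact: open_lt.
by move=> x _; apply: cvg_norm; apply: cvgB; [exact: cvg_id|exact: cvg_cst].
Qed.

(** * Almost sure comparison and limits *)

Section almost_sure.
Context d (Omega : measurableType d) (R : realType) (P : probability Omega R).

Lemma measure_le_ae (A B N : set Omega) : measurable A -> measurable B ->
  P.-negligible N -> A `<=` B `|` N -> (P A <= P B)%E.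
Proof.
move=> mA mB [M [mM M0 NM]] AB.
rewrite -[leRHS]adde0 -M0; apply: (le_trans _ (measureU2 _ mB mM)).
apply: le_measure; rewrite ?inE//; first exact: measurableU.
by move=> w /AB[Bw|/NM Mw]; [left|right].
Qed.

Lemma measurable_preimage (f : Omega -> R) (B : set R) :
  measurable_fun setT f -> measurable B -> measurable (f @^-1` B).
Proof. by move=> mf mB; rewrite -[X in measurable X]setTI; exact: mf. Qed.

(** The preimages under [f] and [g] differ only inside a null set, and completeness makes every
    subset of it measurable. Measurability of the time average is obtained this way. *)
Lemma probability_ae_eq (f g : Omega -> R) (B : set R) :
  measure_is_complete P -> measurable_fun setT f ->
  {ae P, forall w, f w = g w} -> measurable B ->
  measurable (g @^-1` B) /\ P (g @^-1` B) = P (f @^-1` B).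
Proof.
move=> cP mf fg mB.
have mfB := measurable_preimage mf mB.
have mgB : measurable (g @^-1` B).
  have [N [mN N0 fgN]] := fg.
  rewrite (_ : g @^-1` B = (f @^-1` B `\` N) `|` (g @^-1` B `&` N)).
    apply: measurableU; first exact: measurableD.
    by apply: cP; exists N; split => //; exact: subIsetr.
  have fE w : ~ N w -> f w = g w by move=> Nw; apply: contrapT => /fgN.
  apply/seteqP; split => w /=.
    by case: (pselect (N w)) => [|Nw]; [right|left; rewrite fE].
  by move=> [[+ Nw]|[]//]; rewrite fE.
split=> //; apply/eqP; rewrite eq_le; apply/andP; split.
  apply: (measure_le_ae mgB mfB fg) => w /= gB.
  by case: (pselect (f w = g w)) => [->|]; [left|right].
apply: (measure_le_ae mfB mgB fg) => w /= fB.
by case: (pselect (f w = g w)) => [<-|]; [left|right].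
Qed.

(** If the limit lies in the open set [U], so do all late terms. Almost surely the event for [G] is
    thus contained in the increasing union of the [E m], and continuity from below carries the bound
    over. *)
Lemma probability_ae_cvg_open (G_ : nat -> Omega -> R) (G : Omega -> R)
    (U : set R) (K : \bar R) :
  (forall n, measurable_fun setT (G_ n)) -> measurable_fun setT G ->
  {ae P, forall w, G_ n w @[n --> \oo] --> G w} -> open U ->
  (\forall n \near \oo, P (G_ n @^-1` U) <= K)%E -> (P (G @^-1` U) <= K)%E.
Proof.
move=> mG_ mG G_G oU PK.
have mU : measurable U by exact: open_measurable.
pose E m := \bigcap_n (G_ (m + n)%N @^-1` U).
have mE m : measurable (E m).
  by apply: bigcapT_measurable => n; exact: measurable_preimage.
have ndE : {homo E : n m / (n <= m)%N >-> (n <= m)%O}.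
  move=> n m nm; apply/subsetPset => w En k _ /=.
  by have := En (m - n + k)%N I; rewrite /= addnA subnKC.
have mUE : measurable (\bigcup_m E m) by exact: bigcupT_measurable.
apply: (@le_trans _ _ (P (\bigcup_m E m))).
  apply: (measure_le_ae _ mUE G_G); first exact: measurable_preimage.
  move=> w /= UGw.
  case: (pselect (G_ n w @[n --> \oo] --> G w)) => [cw|]; [left|by right].
  have [m _ hm] : \forall n \near \oo, U (G_ n w).
    by apply: cw; exact: open_nbhs_nbhs.
  by exists m => // n _ /=; apply: hm => /=; exact: leq_addr.
have cE := nondecreasing_cvg_mu (mu := P) mE mUE ndE.
rewrite -(cvg_lim (@ereal_hausdorff R) cE); apply: lime_le.
  by apply/cvg_ex; exists (P (\bigcup_m E m)).
near=> n; apply: (@le_trans _ _ (P (G_ n @^-1` U))); last by near: n.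
apply: le_measure; rewrite ?inE//; first exact: measurable_preimage.
by move=> w /(_ 0%N I); rewrite /= addn0.
Unshelve. all: by end_near. Qed.

End almost_sure.

(** * Tail and interval bounds for the mean position *)

Section oscillator_bounds.
Context (R : realType) d (Omega : measurableType d) (P : probability Omega R).
Variables (F : R -> set (set Omega)) (W X Y : R -> Omega -> R).
Variables (alpha x0 y0 : R).
Hypothesis hF : complete_filtered_probability_space P F.
Hypothesis hW : standard_brownian_motion P F W.
Hypothesis halpha : 0 < alpha.
Hypothesis hXY : oscillator_solution P alpha x0 y0 F W X Y.

Let drift (T : R) := x0 * sin T + y0 * (1 - cos T).

Let noise T n w := alpha * \sum_(k < n.+1)
  (1 - cos (T - k.+1%:R * (T / n.+1%:R))) *
  (W (k.+1%:R * (T / n.+1%:R)) w - W (k%:R * (T / n.+1%:R)) w).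

(** The velocity equation solved for the integral of [X]: an expression whose measurability follows
    at once from adaptedness. *)
Let area T w := y0 - Y T w + alpha * (W T w - W 0 w).

Let drift_le (T : R) : `|drift T| <= `|x0| + 2 * `|y0|.
Proof.
rewrite /drift; apply: (le_trans (ler_normD _ _)); rewrite !normrM.
have : `|sin T| <= 1 by rewrite ler_norml sin_geN1 sin_le1.
have : `|1 - cos T| <= 2.
  by have := cos_le1 T; have := cos_geN1 T; rewrite ler_norml; lra.
have := normr_ge0 x0; have := normr_ge0 y0; nra.
Qed.

Let measurable_area (T : R) : 0 <= T -> measurable_fun setT (area T).
Proof.
move=> T0; have mV (V : R -> Omega -> R) s : adapted F V -> 0 <= s ->
    measurable_fun setT (V s).
  move=> aV s0; apply: (filtration_measurable_fun hF s0).
  by apply/(filtration_measurable_funP hF _ s0) => B mB; exact: aV.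
apply: measurable_funD.
  by apply: measurable_funB => //; exact: mV (osc_adapted_vel hXY) T0.
apply: measurable_funM => //; apply: measurable_funB.
  exact: mV (sbm_adapted hW) T0.
exact: mV (sbm_adapted hW) (lexx 0).
Qed.

Let area_integral (T : R) : 0 <= T ->
  {ae P, forall w, area T w = \int[lebesgue_measure]_(t in `[0, T]) X t w}.
Proof.
move=> T0; apply: filterS (osc_vel hXY) => w /(_ T T0) hY.
by rewrite /area hY; ring.
Qed.

Let noise_cvg (T : R) : 0 < T ->
  {ae P, forall w, drift T + noise T n w @[n --> \oo] --> area T w}.
Proof.
move=> T0; have hA := area_integral (ltW T0).
apply: filterS (filterI (filterI (osc_pos hXY) (osc_vel hXY)) (filterI hA
  (filterI (sbm_continuous hW)
    (filterI (osc_continuous_pos hXY) (osc_continuous_vel hXY))))).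
move=> w [[eX eY] [-> [cW [cX cY]]]].
have sub : `[0, T] `<=` `[0, +oo[ by apply: subset_itvl.
have t0 t : t \in `[0, T] -> 0 <= t by rewrite in_itv => /andP[].
by apply: (oscillator_path_sum T0 halpha (Y := Y ^~ w) (X := X ^~ w)
  (W := W ^~ w) (continuous_subspaceW sub cX) (continuous_subspaceW sub cY)
  (continuous_subspaceW sub cW)) => t /t0; [exact: eX|exact: eY].
Qed.

Let measurable_noise (T : R) n : 0 < T ->
  measurable_fun setT (fun w => drift T + noise T n w).
Proof.
move=> T0; apply: measurable_funD => //; apply: measurable_funM => //.
have h0 : 0 < T / n.+1%:R by rewrite divr_gt0.
by have [_ []] := brownian_sum_mgf hF hW
  (fun k => 1 - cos (T - k.+1%:R * (T / n.+1%:R))) n.+1 h0.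
Qed.

(** Once [n] exceeds [8 * T * T], the mesh error is at most 1/2; with the oscillating 5/2 this gives
    the margin 3. For [T > 2] the lower variance bound is positive. *)
Let noise_mgf (T : R) : 2 < T ->
  \forall n \near \oo, exists2 v, gaussian_mgf P (noise T n) v &
    alpha ^+ 2 * (3 / 2 * T - 3) <= v <= alpha ^+ 2 * (3 / 2 * T + 3).
Proof.
move=> T2; have T0 : 0 < T by lra.
near=> n.
have h0 : 0 < T / n.+1%:R by rewrite divr_gt0.
have nh : n.+1%:R * (T / n.+1%:R) = T by rewrite mulrCA divff ?mulr1// gt_eqF.
have [_ hS] := brownian_sum_mgf hF hW
  (fun k => 1 - cos (T - k.+1%:R * (T / n.+1%:R))) n.+1 h0.
exists (alpha ^+ 2 * \sum_(k < n.+1)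
  (1 - cos (T - k.+1%:R * (T / n.+1%:R))) ^+ 2 * (T / n.+1%:R)).
  exact: gaussian_mgfZ.
have a2 : 0 < alpha ^+ 2 by rewrite exprn_gt0.
rewrite !ler_pM2l//.
have n1 : 4 * T * (T / n.+1%:R) <= 2^-1.
  have nT : 8 * T * T < n%:R by near: n; exact: nbhs_infty_gtr.
  have nS : n%:R <= n.+1%:R :> R by rewrite ler_nat.
  by rewrite mulrA ler_pdivrMr//; lra.
have := one_sub_cos_sqr_sum h0 nh.
rewrite ler_norml; set S := \sum_(k < _) _; set q := T / _ in n1 *.
by move=> /andP[n2 n3]; apply/andP; split; lra.
Unshelve. all: by end_near. Qed.

Lemma mean_position_measurable (T : R) (B : set R) : 0 < T -> measurable B ->
  measurable (mean_position X T @^-1` B) /\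
  P (mean_position X T @^-1` B) = P [set w | B (T^-1 * area T w)].
Proof.
move=> T0 mB.
apply: (probability_ae_eq (f := fun w => T^-1 * area T w)
  (cfps_complete hF)) => //.
  by apply: measurable_funM => //; apply: measurable_area; exact: ltW.
by apply: filterS (area_integral (ltW T0)) => w ->.
Qed.

(** The drift is at most [C] in absolute value, so a large area forces the noise beyond [T * r - C]
    on one side or the other; the two tails give the factor 2. *)
Lemma mean_position_upper (T r : R) : 2 < T -> `|x0| + 2 * `|y0| <= T * r ->
  (P (mean_position X T @^-1` [set y | (r < `|y|)%R]) <=
   (2 * expR (- ((T * r - (`|x0| + 2 * `|y0|)) ^+ 2 /
     (2 * (alpha ^+ 2 * (3 / 2 * T + 3))))))%:E)%E.
Proof.
move=> T2 Cr; have T0 : 0 < T by lra.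
set C := `|x0| + 2 * `|y0| in Cr *.
have V0 : 0 < alpha ^+ 2 * (3 / 2 * T + 3).
  by rewrite mulr_gt0 ?exprn_gt0//; lra.
have oU (s : R) : open [set x : R | s < `|x|].
  by have := @open_dist_gt R 0 s; under eq_set do rewrite subr0.
rewrite (mean_position_measurable T0 _).2; last exact: open_measurable.
rewrite (_ : [set _ | _] = area T @^-1` [set x | T * r < `|x|]); last first.
  apply/seteqP; split => w /=.
    by rewrite normrM (gtr0_norm (_ : 0 < T^-1)) ?invr_gt0// ltr_pdivlMl.
  by rewrite normrM (gtr0_norm (_ : 0 < T^-1)) ?invr_gt0// ltr_pdivlMl.
apply: (probability_ae_cvg_open (fun n => measurable_noise n T0)
  (measurable_area (ltW T0)) (noise_cvg T0) (oU _)).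
apply: filterS (noise_mgf T2) => n [v hv /andP[_ vV]].
have [mZ _] := hv.
have Cr0 : 0 <= T * r - C by rewrite subr_ge0.
apply: (@le_trans _ _ (P ([set w | (T * r - C <= noise T n w)%R] `|`
  [set w | (T * r - C <= - noise T n w)%R]))).
  apply: le_measure; rewrite ?inE.
  - by apply: measurable_preimage;
      [exact: measurable_noise|exact: open_measurable].
  - by apply: measurableU; apply: measurable_ge => //; exact: measurable_funN.
  - move=> w /= h; have h1 := ler_normD (drift T) (noise T n w).
    have := drift_le T; rewrite -/C => h2.
    have [z0|z0] := leP 0 (noise T n w); [left|right].
      by rewrite (ger0_norm z0) in h1; lra.
    by rewrite (ltr0_norm z0) in h1; lra.
apply: (le_trans (measureU2 _ _ _)).
- exact: measurable_ge.
- by apply: measurable_ge; exact: measurable_funN.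
rewrite mulr_natl mulr2n EFinD.
apply: leeD; first exact: (gaussian_upper_tail hv).
exact: (gaussian_upper_tail (gaussian_mgfN hv)).
Qed.

(** The radius [2 * e] is shared equally: noise within [T * e] of [T * y], and a drift of size at
    most [T * e]. The closed ball has an open complement, so the limit in [n] is taken as an upper
    bound on that complement. *)
Lemma mean_position_lower (T y e : R) : 2 < T ->
  `|x0| + 2 * `|y0| <= T * e -> 0 < e ->
  ((expR (- (((T * y) ^+ 2 + 2 * `|T * y| * (T * e)) /
      (2 * (alpha ^+ 2 * (3 / 2 * T - 3))))) *
    (1 - 2 * expR (- ((T * e) ^+ 2 /
      (2 * (alpha ^+ 2 * (3 / 2 * T + 3)))))))%:E <=
   P (mean_position X T @^-1` [set z | (`|z - y| <= 2 * e)%R]))%E.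
Proof.
move=> T2 Ce e0; have T0 : 0 < T by lra.
set C := `|x0| + 2 * `|y0| in Ce *.
have Te0 : 0 < T * e by rewrite mulr_gt0.
have v0 : 0 < alpha ^+ 2 * (3 / 2 * T - 3).
  by rewrite mulr_gt0 ?exprn_gt0//; lra.
pose U := [set x : R | 2 * (T * e) < `|x - T * y|].
have oU : open U by exact: open_dist_gt.
have mU : measurable U by exact: open_measurable.
have mB : measurable [set z : R | `|z - y| <= 2 * e].
  rewrite (_ : [set _ | _] = ~` [set z | 2 * e < `|z - y|]).
    by apply: measurableC; apply: open_measurable; exact: open_dist_gt.
  by apply/seteqP; split => z /=; rewrite leNgt => /negP.
rewrite (mean_position_measurable T0 mB).2.
rewrite (_ : [set _ | _] = ~` (area T @^-1` U)); last first.
  have E w : (`|T^-1 * area T w - y| <= 2 * e) =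
      ~~ (2 * (T * e) < `|area T w - T * y|).
    rewrite -leNgt (_ : area T w - T * y = T * (T^-1 * area T w - y)).
      by rewrite normrM (gtr0_norm T0) mulrCA ler_pM2l.
    by field; exact: lt0r_neq0.
  by apply/seteqP; split => w /=; rewrite E => /negP.
have inv_le2 (u u' : R) : 0 < u -> u <= u' -> (2 * u')^-1 <= (2 * u)^-1.
  move=> u0 uu'; have u'0 := lt_le_trans u0 uu'.
  by rewrite lef_pV2 ?posrE; [rewrite ler_pM2l|exact: mulr_gt0|exact: mulr_gt0].
set L := _ * (1 - _).
have mAU : measurable (area T @^-1` U).
  by apply: measurable_preimage => //; exact: measurable_area (ltW T0).
rewrite probability_setC//.
suff : (P (area T @^-1` U) <= (1 - L)%:E)%E.
  have fU := fin_num_measure P _ mAU.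
  rewrite -(fineK fU) -EFinB !lee_fin; lra.
apply: (probability_ae_cvg_open (fun n => measurable_noise n T0)
  (measurable_area (ltW T0)) (noise_cvg T0) oU).
apply: filterS (noise_mgf T2) => n [v hv /andP[vV1 vV2]].
have vp : 0 < v by exact: lt_le_trans vV1.
have [mZ _] := hv.
have mI : measurable [set w | `|noise T n w - T * y| < T * e].
  apply: (measurable_preimage mZ (B := [set x | `|x - T * y| < T * e])).
  by apply: open_measurable; exact: open_dist_lt.
apply: (@le_trans _ _ (P (~` [set w | (`|noise T n w - T * y| < T * e)%R]))).
  apply: le_measure; rewrite ?inE.
  - by apply: measurable_preimage => //; exact: measurable_noise.
  - exact: measurableC.
  - move=> w /=; rewrite /U/= => h1 h2.
    have := drift_le T; rewrite -/C => h3.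
    have := ler_normD (drift T) (noise T n w - T * y).
    rewrite addrA; lra.
rewrite probability_setC//.
have := gaussian_interval_ge (T * y) hv vp Te0.
have fI := fin_num_measure P _ mI.
rewrite -(fineK fI) -EFinB !lee_fin => h.
rewrite lerD2l lerN2 /L.
(* Comparing products needs nonnegative factors; when [q] is not positive the bound is trivial.
   Otherwise the first factor uses the lower variance bound and the second the upper one. *)
set q := 1 - _; have [q0|q0] := leP q 0.
  by apply: (@le_trans _ _ 0); [rewrite mulr_ge0_le0 ?expR_ge0|exact: fine_ge0].
apply: le_trans h; apply: ler_pM; rewrite ?expR_ge0//; first exact: ltW.
  rewrite ler_expR lerN2; apply: ler_wpM2l.
    by rewrite addr_ge0 ?sqr_ge0// mulr_ge0// ltW.
  by apply: inv_le2; [exact: v0|exact: vV1].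
rewrite /q lerD2l lerN2 ler_pM2l// ler_expR lerN2.
by apply: ler_wpM2l; [exact: sqr_ge0|apply: inv_le2; [exact: vp|exact: vV2]].
Qed.

End oscillator_bounds.

(** * The large deviations principle *)

Section limits.
Context (R : realType).
Local Open Scope ereal_scope.

Lemma ereal_le_lt_fin (x y : \bar R) :
  (forall c : R, c%:E < x -> c%:E <= y) -> x <= y.
Proof.
move=> h; rewrite leNgt; apply/negP => yx.
have [c yc cx] : exists2 c : R, y < c%:E & c%:E < x.
  case: x y yx {h} => [x| |] [y| |]//=.
  - rewrite lte_fin => yx; exists ((x + y) / 2)%R; rewrite lte_fin; lra.
  - by move=> _; exists (x - 1)%R; rewrite ?ltNyr// lte_fin; lra.
  - by move=> _; exists (y + 1)%R; rewrite ?ltry// lte_fin; lra.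
  - by move=> _; exists 0%R; rewrite ?ltry// ltNyr.
by have := le_lt_trans (h c cx) yc; rewrite ltxx.
Qed.

Lemma limf_esup_le_near (f : R -> \bar R) (F : set_system R) (a : \bar R) :
  (\forall x \near F, f x <= a) -> limf_esup f F <= a.
Proof.
move=> fa; rewrite limf_esupE; apply: ge_ereal_inf.
exists (ereal_sup (f @` [set x | f x <= a])).
  by exists [set x | f x <= a].
by apply: ge_ereal_sup => _ [x /= fxa <-].
Qed.

Lemma limf_einf_ge_near (f : R -> \bar R) (F : set_system R) (a : \bar R) :
  (\forall x \near F, a <= f x) -> a <= limf_einf f F.
Proof.
move=> fa; rewrite limf_einfE; apply: le_ereal_sup_tmp.
exists (ereal_inf (f @` [set x | a <= f x])).
  by exists [set x | a <= f x].
by apply: le_ereal_inf_tmp => _ [x /= fxa <-].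
Qed.

Lemma scaled_lne_le (T B : R) (p : \bar R) : (0 < T)%R -> (0 < B)%R ->
  0 <= p -> p <= B%:E -> (T^-1)%:E * lne p <= (T^-1 * ln B)%:E.
Proof.
move=> T0 B0 p0 pB; rewrite EFinM -(lne_EFin B0).
apply: lee_wpmul2l; first by rewrite lee_fin invr_ge0 ltW.
by rewrite lee_lne// in_itv/= ?p0 ?leey// lee_fin ltW.
Qed.

Lemma scaled_lne_ge (T B : R) (p : \bar R) : (0 < T)%R -> (0 < B)%R ->
  B%:E <= p -> (T^-1 * ln B)%:E <= (T^-1)%:E * lne p.
Proof.
move=> T0 B0 pB; rewrite EFinM -(lne_EFin B0).
have p0 : 0 <= p by apply: le_trans pB; rewrite lee_fin ltW.
apply: lee_wpmul2l; first by rewrite lee_fin invr_ge0 ltW.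
by rewrite lee_lne// in_itv/= ?p0 ?leey// lee_fin ltW.
Qed.

End limits.

Lemma quadratic_good_rate_function (R : realType) (K : R) : 0 < K ->
  good_rate_function (fun y : R => (y ^+ 2 / K)%:E).
Proof.
move=> K0; split; first split.
- by move=> y; rewrite lee_fin divr_ge0// ?sqr_ge0// ltW.
- apply/lower_semicontinuousP => a.
  rewrite (_ : [set _ | _] = (fun y => y ^+ 2 / K) @^-1` [set x | a < x])//.
    apply: open_comp; last exact: open_gt.
    by move=> x _; apply: cvgM; [exact: exprn_continuous|exact: cvg_cst].
- move=> a a0.
  rewrite (_ : [set _ | _] = `[- Num.sqrt (a * K), Num.sqrt (a * K)]%classic).
    exact: segment_compact.
  apply/seteqP; split => y /=;
    rewrite lee_fin ler_pdivrMr// in_itv/= -ler_norml.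
    by rewrite -sqrtr_sqr => h; rewrite ler_wsqrtr.
  by rewrite -sqrtr_sqr ler_sqrt// mulr_ge0// ltW.
Qed.

(** * Exponential rates as time grows *)

Section oscillator_ldp.
Context (R : realType) d (Omega : measurableType d) (P : probability Omega R).
Variables (F : R -> set (set Omega)) (W X Y : R -> Omega -> R).
Variables (alpha x0 y0 : R).
Hypothesis hF : complete_filtered_probability_space P F.
Hypothesis hW : standard_brownian_motion P F W.
Hypothesis halpha : 0 < alpha.
Hypothesis hXY : oscillator_solution P alpha x0 y0 F W X Y.

Let I (y : R) : \bar R := (y ^+ 2 / (3 * alpha ^+ 2))%:E.
Let K := alpha ^+ 2.
Let K0 : 0 < K. Proof. by rewrite exprn_gt0. Qed.
Let C := `|x0| + 2 * `|y0|.
Let L := ln (2 : R).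

Let log2_gt0 : 0 < L. Proof. by rewrite ln_gt0// ltr1n. Qed.

Let rate T (B : set R) : \bar R :=
  ((T^-1)%:E * lne (P (mean_position X T @^-1` B)))%E.

(** The level [I y = c] is reached at [|y| = r] with [r ^+ 2 = 3 * K * c], so [B] lies beyond radius
    [r], where the two-sided tail decays at rate [c]. *)
Let rate_le_outside (B : set R) (c e : R) : closed B -> 0 < c -> 0 < e ->
  (forall y, B y -> c%:E < I y)%E ->
  \forall T \near +oo, (rate T B <= (- c + e)%:E)%E.
Proof.
move=> cB c0 e0 cI; pose r := Num.sqrt (3 * K * c).
have r0 : 0 < r by rewrite sqrtr_gt0 !mulr_gt0.
have r2 : r ^+ 2 = 3 * K * c by rewrite sqr_sqrtr// ltW// !mulr_gt0.
near=> T.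
have T2 : 2 < T by near: T; apply: nbhs_pinfty_gt; exact: num_real.
have T0 : 0 < T by lra.
have TC : C <= T * r.
  rewrite -ler_pdivrMr//; near: T; apply: nbhs_pinfty_ge; exact: num_real.
(* The target inequality multiplied out and divided by [T]: [9 * L * K] comes from the factor 2 of
   the tail, [2 * r * C] from the drift, [6 * c * K] from the excess 3 in the variance bound. *)
have TM : 9 * L * K + 2 * r * C + 6 * c * K < 3 * e * K * T.
  rewrite -ltr_pdivrMl ?mulr_gt0//; near: T;
    apply: nbhs_pinfty_gt; exact: num_real.
have BR : B `<=` [set y | r < `|y|].
  move=> y /cI; rewrite /I lte_fin ltr_pdivlMr ?mulr_gt0// => h.
  rewrite /= -sqrtr_sqr ltr_sqrt.
    by rewrite mulrC.
  by apply: le_lt_trans h; rewrite !mulr_ge0// ltW.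
have mB := closed_measurable cB.
have mO : measurable [set y : R | r < `|y|].
  apply: open_measurable; have := @open_dist_gt R 0 r.
  by under eq_set do rewrite subr0.
have PB : (P (mean_position X T @^-1` B) <=
   P (mean_position X T @^-1` [set y | (r < `|y|)%R]))%E.
  apply: le_measure; rewrite ?inE.
  - exact: (mean_position_measurable hF hW hXY T0 mB).1.
  - exact: (mean_position_measurable hF hW hXY T0 mO).1.
  - by move=> w /BR.
have := le_trans PB (mean_position_upper hF hW halpha hXY T2 TC).
rewrite -/K -/C => PB2.
apply: (le_trans (scaled_lne_le T0 _ _ PB2)); rewrite ?mulr_gt0 ?expR_gt0//.
rewrite lee_fin lnM ?posrE ?expR_gt0// expRK -/L ler_pdivrMl//.
have KT : 0 < 2 * (K * (3 / 2 * T + 3)) by rewrite !mulr_gt0//; lra.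
rewrite lerBlDr -lerBlDl.
rewrite ler_pdivlMr// sqrrB exprMn r2.
have TTM : T * (9 * L * K + 2 * r * C + 6 * c * K) <= T * (3 * e * K * T).
  by rewrite ler_pM2l// ltW.
have LKT : 0 <= L * K * (T - 1) by rewrite !mulr_ge0// ?ltW// subr_gt0; lra.
have eKT : 0 <= e * K * T by rewrite !mulr_ge0// ltW.
have C2 := sqr_ge0 C.
move: TTM LKT eKT C2; rewrite !expr2; lra.
Unshelve. all: by end_near. Qed.

Let rate_ge (U : set R) (y e : R) : open U -> U y -> 0 < e ->
  \forall T \near +oo, ((- (y ^+ 2 / (3 * alpha ^+ 2)) - e)%:E <= rate T U)%E.
Proof.
move=> oU Uy e0.
have [rho rho0 ballU] : exists2 rho, 0 < rho & ball y rho `<=` U.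
  by apply/nbhs_ballP; exact: open_nbhs_nbhs.
have y1 : 0 < 2 * `|y| + 1 by rewrite ltr_wpDl// mulr_ge0.
(* The first bound keeps the ball of radius [2 * delta] inside [U]; the second makes the cross term
   [2 * |y| * delta] at most [e * K]. The added 1 covers [y = 0]. *)
pose delta := Num.min (rho / 4) (e * K / (2 * `|y| + 1)).
have delta0 : 0 < delta by rewrite lt_min !divr_gt0// mulr_gt0.
have delta_rho : 2 * delta < rho.
  have : delta <= rho / 4 by rewrite /delta ge_min lexx.
  lra.
have delta_y : 2 * `|y| * delta <= e * K.
  have : delta <= e * K / (2 * `|y| + 1) by rewrite /delta ge_min lexx orbT.
  by rewrite ler_pdivlMr// => h; move: h delta0; lra.
near=> T.
have T2 : 2 < T by near: T; apply: nbhs_pinfty_gt; exact: num_real.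
have T0 : 0 < T by lra.
have TC : C <= T * delta.
  rewrite -ler_pdivrMr//; near: T; apply: nbhs_pinfty_ge; exact: num_real.
have Texp : 12 * L * K <= T * delta ^+ 2.
  rewrite -ler_pdivrMr ?exprn_gt0//; near: T;
    apply: nbhs_pinfty_ge; exact: num_real.
have TL : 3 * L <= T * e.
  rewrite -ler_pdivrMr//; near: T; apply: nbhs_pinfty_ge; exact: num_real.
have TK : 6 * y ^+ 2 + 12 * (K * e) <= T * (3 * (K * e)).
  rewrite -ler_pdivrMr ?mulr_gt0//; near: T;
    apply: nbhs_pinfty_ge; exact: num_real.
have T6 : 0 < 2 * (K * (3 / 2 * T + 3)) by rewrite !mulr_gt0//; lra.
have T6' : 0 < 2 * (K * (3 / 2 * T - 3)) by rewrite !mulr_gt0//; lra.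
(* By [Texp] the exponential is at most [expR (- (L + L))], that is 1/4, so the tilted mass of the
   interval is at least 1/2. *)
have half : 2^-1 <=
    1 - 2 * expR (- ((T * delta) ^+ 2 / (2 * (K * (3 / 2 * T + 3))))).
  have : expR (- ((T * delta) ^+ 2 / (2 * (K * (3 / 2 * T + 3))))) <= 4^-1.
    rewrite (_ : 4^-1 = expR (- (L + L))).
      rewrite ler_expR lerN2 ler_pdivlMr// exprMn.
      have h1 : 0 <= L * K * (T - 2) by rewrite !mulr_ge0// ?ltW// subr_gt0.
      have h2 : T * (12 * L * K) <= T * (T * delta ^+ 2) by rewrite ler_pM2l.
      by rewrite (expr2 T); lra.
    by rewrite expRN expRD lnK ?posrE//; field.
  lra.
have mB : measurable [set z : R | `|z - y| <= 2 * delta].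
  rewrite (_ : [set _ | _] = ~` [set z | 2 * delta < `|z - y|]).
    by apply: measurableC; apply: open_measurable; exact: open_dist_gt.
  by apply/seteqP; split => z /=; rewrite leNgt => /negP.
have PU : (P (mean_position X T @^-1` [set z | (`|z - y| <= 2 * delta)%R]) <=
    P (mean_position X T @^-1` U))%E.
  apply: le_measure; rewrite ?inE.
  - exact: (mean_position_measurable hF hW hXY T0 mB).1.
  - exact: (mean_position_measurable hF hW hXY T0 (open_measurable oU)).1.
  - move=> w /= h; apply: ballU; rewrite /ball/= distrC.
    exact: le_lt_trans h delta_rho.
have := le_trans (mean_position_lower hF hW halpha hXY y T2 TC delta0) PU.
rewrite -/K.
set E := ((T * y) ^+ 2 + 2 * `|T * y| * (T * delta)) /
  (2 * (K * (3 / 2 * T - 3))).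
move=> PL.
have {}PL : ((expR (- E) * 2^-1)%:E <= P (mean_position X T @^-1` U))%E.
  by apply: le_trans PL; rewrite lee_fin ler_pM2l ?expR_gt0.
apply: le_trans (scaled_lne_ge T0 _ PL); last by rewrite mulr_gt0 ?expR_gt0.
rewrite lee_fin lnM ?posrE ?expR_gt0// expRK lnV ?posrE// -/L ler_pdivlMl//.
(* The allowance [e] is split: two thirds for [E], one third for the factor 1/2, whose logarithm is
   absorbed by [TL]. *)
suff : 3 * E <= T * (y ^+ 2 / K + 2 * e).
  rewrite -/K; have -> : y ^+ 2 / (3 * K) = (y ^+ 2 / K) / 3.
    by field; exact: lt0r_neq0.
  by set z := y ^+ 2 / K; lra.
rewrite /E mulrA ler_pdivrMr//.
have -> : T * (y ^+ 2 / K + 2 * e) * (2 * (K * (3 / 2 * T - 3))) =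
    T * ((y ^+ 2 + 2 * (K * e)) * (3 * T - 6)).
  by field; exact: lt0r_neq0.
rewrite normrM (gtr0_norm T0).
have -> : 3 * ((T * y) ^+ 2 + 2 * (T * `|y|) * (T * delta)) =
  T * (3 * T * (y ^+ 2 + 2 * `|y| * delta)) by ring.
rewrite ler_pM2l//.
have : T * (2 * `|y| * delta) <= T * (e * K) by rewrite ler_pM2l.
by set z := 2 * `|y| * delta; lra.
Unshelve. all: by end_near. Qed.

Lemma mean_position_ldp : large_deviations_principle P (mean_position X) I.
Proof.
split.
  move=> U oU; rewrite leeNl; apply: le_ereal_inf_tmp => _ [y Uy <-].
  rewrite leeNl; apply/lee_subgt0Pr => e e0.
  by apply: limf_einf_ge_near; exact: rate_ge.
(* Testing against real [c] below the infimum also covers the empty set, whose infimum is [+oo]. *)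
move=> B cB; rewrite leeNr; apply: ereal_le_lt_fin => c cI.
have cIy y : B y -> (c%:E < I y)%E.
  by move=> By; apply: (lt_le_trans cI); apply: ereal_inf_lbound; exists y.
rewrite leeNr.
have [c0|c0] := ltP 0 c.
  apply/lee_addgt0Pr => e e0; apply: limf_esup_le_near.
  exact: rate_le_outside.
(* For [c <= 0] the bound follows from probabilities being at most 1, which makes every rate
   nonpositive. *)
apply: (@le_trans _ _ 0%E); last by rewrite oppe_ge0 lee_fin.
apply: limf_esup_le_near; near=> T.
have T0 : 0 < T by near: T; apply: nbhs_pinfty_gt; exact: num_real.
apply: mule_ge0_le0; first by rewrite lee_fin invr_ge0 ltW.
rewrite lne_le0; apply: probability_le1.
exact: (mean_position_measurable hF hW hXY T0 (closed_measurable cB)).1.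
Unshelve. all: by end_near. Qed.

End oscillator_ldp.

Theorem theorem2p5 (R : realType) (d : measure_display)
    (Omega : measurableType d) (P : probability Omega R)
    (F : R -> set (set Omega)) (W X Y : R -> Omega -> R) (alpha x0 y0 : R)
    (hF : complete_filtered_probability_space P F)
    (hW : standard_brownian_motion P F W)
    (halpha : 0 < alpha)
    (hXY : oscillator_solution P alpha x0 y0 F W X Y) :
  let I : R -> \bar R := fun y => (y ^+ 2 / (3 * alpha ^+ 2))%:E in
  good_rate_function I /\
  large_deviations_principle P (mean_position X) I.
Proof.
split; last exact: (mean_position_ldp hF hW halpha hXY).
by apply: quadratic_good_rate_function; rewrite mulr_gt0 ?exprn_gt0.
Qed.
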